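(* Let $\varphi\in\mathscr{A}(D_\Delta)$ and $\lambda:=\frac{m}{2^jn}$, where $m,j\geq0$ are integers, $n\geq1$ is an odd integer, $m\leq2^{j-1}n$, and $m$ and $2^jn$ are coprime. Let $\ell:=\left\lfloor\frac12\phi(n)\right\rfloor$, where $\phi$ is Euler's totient function. Then, for all $u\in D_\Delta$, $$\sum_{k=0}^\infty\frac{1}{2^k}\varphi^*\big(d_{\mathbb{Z}}(2^k\lambda)u\big)=\sum_{k=0}^{j-1}\frac{1}{2^k}\varphi^*\big(d_{\mathbb{Z}}(2^k\lambda)u\big)+\sum_{k=j}^{j+\ell-1}\frac{1}{2^k-2^{k-\ell}}\varphi^*\big(d_{\mathbb{Z}}(2^k\lambda)u\big).$$
   Context: $\mathbb{N}=\{1,2,3,\dots\}$. $X$ is a real linear space and $D\subseteq X$ is a nonempty convex set; $D_\Delta:=\{x-y : x,y\in D\}$. Given $\varphi:\frac12D_\Delta\to\mathbb{R}$, a function $f:D\to\mathbb{R}$ is called $\varphi$-Jensen convex if $f\big(\frac{x+y}{2}\big)\leq\frac12f(x)+\frac12f(y)+\varphi\big(\frac{x-y}{2}\big)$ for all $x,y\in D$. $\mathscr{A}(D_\Delta)$ denotes the family of all admissible error functions, i.e. of all even functions $\varphi:\frac12D_\Delta\to\mathbb{R}$ with $\varphi(0)=0$ for which there exists at least one $\varphi$-Jensen convex function $f:D\to\mathbb{R}$. For $\varphi:\frac12D_\Delta\to\mathbb{R}$, define $\varphi^*:\frac12D_\Delta\to[-\infty,\infty)$ by $\varphi^*(u):=\inf_{m\in\mathbb{N}}m^2\varphi\big(\frac{u}{m}\big)$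 (for $\varphi\in\mathscr{A}(D_\Delta)$ the function $\varphi^*$ is real-valued). For $x\in\mathbb{R}$, $d_{\mathbb{Z}}(x):=\inf\{|x-k| : k\in\mathbb{Z}\}$. Empty sums are $0$. *)

(* Defs.v *)
From HB Require Import structures.
From mathcomp Require Import all_boot all_order all_algebra.
From mathcomp Require Import all_classical all_reals all_analysis.
From mathcomp Require Import zify ring lra.
Import Order.TTheory GRing.Theory Num.Theory.
Import numFieldNormedType.Exports.

Set Implicit Arguments.
Unset Strict Implicit.
Unset Printing Implicit Defensive.

Local Open Scope classical_set_scope.
Local Open Scope ring_scope.

(* Functions on D and on (1/2) D_Delta are represented by functions on the
   whole space X; every condition and every evaluation below only involves
   their values on D and on (1/2) D_Delta respectively. *)

Definition diffset (R : realType) (X : lmodType R) (D : set X) : set X :=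
  [set v | exists x y, [/\ D x, D y & v = x - y]].

Definition half_diffset (R : realType) (X : lmodType R) (D : set X) : set X :=
  [set 2^-1 *: v | v in diffset D].

Definition jensen_convex (R : realType) (X : lmodType R) (D : set X)
    (phi f : X -> R) : Prop :=
  forall x y, D x -> D y ->
    f (2^-1 *: (x + y))
      <= 2^-1 * f x + 2^-1 * f y + phi (2^-1 *: (x - y)).

Definition admissible (R : realType) (X : lmodType R) (D : set X)
    (phi : X -> R) : Prop :=
  [/\ forall u, half_diffset D u -> phi (- u) = phi u,
      phi 0 = 0
    & exists f : X -> R, jensen_convex D phi f].

Definition phistar (R : realType) (X : lmodType R) (phi : X -> R) (u : X)
    : \bar R :=
  ereal_inf [set (m%:R ^+ 2 * phi (m%:R^-1 *: u))%:E
            | m in [set m : nat | (0 < m)%N]].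

Definition distZ (R : realType) (x : R) : R :=
  inf [set `|x - k%:~R| | k in [set: int]].

(* Values of phistar are turned into reals by [fine] in the main statement;
   the following lemma shows that nothing is lost on (1/2) D_Delta. *)
Lemma phistar_fin_num (R : realType) (X : lmodType R) (D : set X)
    (phi : X -> R) (u : X) :
  convex_set (D : set (convex_lmodType X)) -> admissible D phi ->
  half_diffset D u -> phistar phi u \is a fin_num.
Proof.
move=> Dcvx [_ _ [f Jf]] [_ [x [y [Dx Dy ->]]] <-].
have [v Ev] : exists v, v = x - y by exists (x - y).
rewrite -Ev.
have Dt (t : R) : 0 <= t -> t <= 1 -> D (y + t *: v).
  move=> t0 t1; pose p : {i01 R} := Itv01 t0 t1.
  have := Dcvx x y p; rewrite !inE => /(_ Dx Dy); rewrite /conv /= /conv /=.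
  rewrite /unstable.onem; congr (D _).
  by rewrite Ev scalerBr scalerBl scale1r addrCA.
have lb (m : nat) : (0 < m)%N ->
    f (y + 2^-1 *: v) - 2^-1 * (f x + f y)
      <= m%:R ^+ 2 * phi (m%:R^-1 *: (2^-1 *: v)).
  move=> m0; set c := phi _.
  have m0' : (m%:R : R) != 0 by rewrite pnatr_eq0 -lt0n.
  have m0R : (0 : R) < m%:R by rewrite ltr0n.
  pose q (s : R) := f (y + ((m%:R + s) / (2 * m%:R)) *: v).
  have step (s : R) : - m%:R + 1 <= s -> s <= m%:R - 1 ->
      q s <= 2^-1 * q (s + 1) + 2^-1 * q (s - 1) + c.
    move=> s1 s2.
    have H := Jf (y + ((m%:R + (s + 1)) / (2 * m%:R)) *: v)
                 (y + ((m%:R + (s - 1)) / (2 * m%:R)) *: v).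
    have le01 (w : R) : - m%:R <= w -> w <= m%:R ->
        D (y + ((m%:R + w) / (2 * m%:R)) *: v).
      move=> w1 w2; apply: Dt.
        by rewrite divr_ge0 //; lra.
      by rewrite ler_pdivrMr; lra.
    move: H => /(_ (le01 _ _ _) (le01 _ _ _)) H.
    have {H} := H ltac:(lra) ltac:(lra) ltac:(lra) ltac:(lra).
    have -> : 2^-1 *: (y + ((m%:R + (s + 1)) / (2 * m%:R)) *: v
        + (y + ((m%:R + (s - 1)) / (2 * m%:R)) *: v))
        = y + ((m%:R + s) / (2 * m%:R)) *: v.
      have -> : y + ((m%:R + (s + 1)) / (2 * m%:R)) *: v
          + (y + ((m%:R + (s - 1)) / (2 * m%:R)) *: v)
          = (2 : R) *: (y + ((m%:R + s) / (2 * m%:R)) *: v).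
        rewrite addrACA -scalerDl scalerDr scalerA scaler_nat mulr2n.
        by congr (_ + _ *: _); field.
      by rewrite scalerA mulVf ?pnatr_eq0 // scale1r.
    have -> : 2^-1 *: (y + ((m%:R + (s + 1)) / (2 * m%:R)) *: v
        - (y + ((m%:R + (s - 1)) / (2 * m%:R)) *: v))
        = m%:R^-1 *: (2^-1 *: v).
      rewrite opprD addrACA subrr add0r -scalerBl !scalerA.
      by congr (_ *: _); field.
    by [].
  pose S (k : nat) := q k%:R + q (- k%:R) + 2 * c * k%:R ^+ 2.
  have Sconv (k : nat) : (k < m)%N -> S 0%N <= S k /\ S k <= S k.+1.
    have S0 : S 0%N = q 0 + q 0 by rewrite /S oppr0 expr0n /= mulr0 addr0.
    have S01 : S 0%N <= S 1%N.
      have := step 0; rewrite add0r sub0r S0 /S.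
      have : (1 : R) <= m%:R by rewrite ler1n.
      by move=> h /(_ ltac:(lra) ltac:(lra)); lra.
    elim: k => [|k IH] km; first by split.
    have [h0 h1] := IH (ltnW km).
    split; first exact: le_trans h0 h1.
    have hk : (k.+2)%:R <= m%:R :> R by rewrite ler_nat.
    have k0 : (0 : R) <= k%:R by [].
    have e1 : (k.+1)%:R = k%:R + 1 :> R by rewrite -natr1.
    have e2 : (k.+2)%:R = k%:R + 2 :> R by rewrite -!natr1; ring.
    have := step (- k.+1%:R); have := step (k.+1%:R).
    have -> : - (k.+1)%:R + 1 = - k%:R :> R by rewrite e1; ring.
    have -> : - (k.+1)%:R - 1 = - k.+2%:R :> R by rewrite e1 e2; ring.
    have -> : (k.+1)%:R - 1 = k%:R :> R by rewrite e1; ring.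
    have -> : (k.+1)%:R + 1 = k.+2%:R :> R by rewrite e1 e2; ring.
    move=> /(_ ltac:(lra) ltac:(lra)) A /(_ ltac:(lra) ltac:(lra)) B.
    move: h1; rewrite /S.
    have -> : 2 * c * (k.+1)%:R ^+ 2 = 2 * c * k%:R ^+ 2 + c * (4 * k%:R + 2).
      by rewrite e1; ring.
    have -> : 2 * c * (k.+2)%:R ^+ 2 = 2 * c * k%:R ^+ 2 + c * (8 * k%:R + 8).
      by rewrite e2; ring.
    by lra.
  have Sm : S 0%N <= S m.
    case: (m) m0 Sconv => // m' _ /(_ m' (ltnSn _)) [h1 h2].
    exact: le_trans h1 h2.
  move: Sm; rewrite /S /q oppr0 addr0 subrr mul0r scale0r addr0.
  have -> : m%:R / (2 * m%:R) = 2^-1 :> R by field.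
  have -> : (m%:R + m%:R) / (2 * m%:R) = 1 :> R by field.
  have -> : y + 1 *: v = x by rewrite scale1r Ev subrKC.
  by rewrite expr0n /=; lra.
rewrite fin_numElt; apply/andP; split.
- apply: (@lt_le_trans _ _ (f (y + 2^-1 *: v) - 2^-1 * (f x + f y))%:E).
    by rewrite ltNyr.
  by apply: le_ereal_inf_tmp => _ [m /= m0 <-]; rewrite lee_fin; exact: lb.
- apply: (@le_lt_trans _ _ (1%:R ^+ 2 * phi (1%:R^-1 *: (2^-1 *: v)))%:E).
    by apply: ereal_inf_lbound; exists 1%N.
  by rewrite ltry.
Qed.

(* Main.v *)
Require Import Defs.
From HB Require Import structures.
From mathcomp Require Import all_boot all_order all_algebra.
From mathcomp Require Import all_classical all_reals all_analysis.
From mathcomp Require cyclic.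
From mathcomp Require Import zify ring.
Import Order.TTheory GRing.Theory Num.Theory.
Import numFieldNormedType.Exports.

Set Implicit Arguments.
Unset Strict Implicit.
Unset Printing Implicit Defensive.

Local Open Scope classical_set_scope.
Local Open Scope ring_scope.

(** Put a_k := phi^*(d_Z(2^k lam) u).  From k = j on, 2^k lam is an integer
    multiple of 1/n, so a_k only depends on 2^(k-j) m modulo n, up to sign,
    because d_Z is even and 1-periodic.  The arithmetic fact behind the formula
    is that 2^l = 1 or -1 modulo n for l = floor(totient n / 2)
    ([exp_half_totient]); hence a_(k+l) = a_k for k >= j, and each residue class
    of k modulo l contributes a geometric series of ratio 2^(-l), with sum
    a_k / (2^k (1 - 2^(-l))) = a_k / (2^k - 2^(k-l))
    ([dyadic_series_periodic]).

    When n = 1 the period l degenerates to 0; then every a_k with k >= j is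
    phi^*(0) = 0, and the series formula is used with period 1 instead.

    For the arithmetic fact, Euler's theorem says that (2^l)^2 = 1 modulo n.
    Modulo a power of an odd prime the only square roots of 1 are 1 and -1.
    If n = a b with a, b > 1 coprime and odd, then both totients are even, so l
    is a multiple of totient a and of totient b, and 2^l = 1 modulo a and
    modulo b. *)

(** * Half of the totient as an exponent *)

Lemma odd_pfactor_split n : odd n -> (1 < n)%N ->
  exists p k n', [/\ prime p, odd p, odd n', coprime (p ^ k.+1) n'
                   & n = p ^ k.+1 * n']%N.
Proof.
move=> n_odd n_gt1; have p_pr := pdiv_prime n_gt1.
have n_gt0 := ltnW n_gt1.
have [n' p'n' En] := pfactor_coprime p_pr n_gt0.
have : (0 < logn (pdiv n) n)%N by rewrite logn_gt0 pi_pdiv.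
case: logn En => // k; rewrite mulnC => En _.
have := n_odd; rewrite En oddM oddX /= => /andP[p_odd n'_odd].
by exists (pdiv n), k, n'; split=> //; rewrite coprimeXl.
Qed.

Lemma totient_pfactor_even p k :
  prime p -> odd p -> ~~ odd (totient (p ^ k.+1)).
Proof.
move=> p_pr p_odd; rewrite totient_pfactor //= oddM -subn1 oddB ?prime_gt0 //.
by rewrite p_odd.
Qed.

Lemma totient_odd_even n : odd n -> (1 < n)%N -> ~~ odd (totient n).
Proof.
move=> n_odd n_gt1.
have [p [k [n' [p_pr p_odd _ co ->]]]] := odd_pfactor_split n_odd n_gt1.
by rewrite totient_coprime // oddM negb_and totient_pfactor_even.
Qed.

(** The factors x - 1 and x + 1 of x^2 - 1 differ by 2, so an odd prime divides
    at most one of them, and that one absorbs the whole prime power. *)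
Lemma sqr_eq1_mod_pfactor p k x : prime p -> odd p -> (0 < x)%N ->
  (x ^ 2 = 1 %[mod p ^ k])%N -> (p ^ k %| x - 1)%N \/ (p ^ k %| x + 1)%N.
Proof.
move=> p_pr p_odd x_gt0 /eqP; rewrite eqn_mod_dvd ?expn_gt0 ?x_gt0 //.
rewrite -{2}(exp1n 2) subn_sqr => dvd.
case: (boolP (p %| x - 1)%N) => [p_dvd|p_ndvd]; last first.
  by right; rewrite -(Gauss_dvdr _ (_ : coprime _ (x - 1)))
    // coprimeXl // prime_coprime.
left; rewrite -(Gauss_dvdl _ (_ : coprime _ (x + 1))) // coprimeXl //.
rewrite prime_coprime //; apply/negP => p_dvd'.
have: (p %| (x + 1) - (x - 1))%N by exact: dvdn_sub.
have -> : (x + 1 - (x - 1) = 2)%N by lia.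
by rewrite dvdn_prime2 // => /eqP p2; move: p_odd; rewrite p2.
Qed.

Lemma exp_half_totient_mull a b x : coprime x a -> ~~ odd (totient b) ->
  (x ^ (totient a * totient b)./2 = 1 %[mod a])%N.
Proof.
move=> co ev.
have -> : ((totient a * totient b)./2 = totient a * (totient b)./2)%N.
  by rewrite -{1}(even_halfK ev) -doubleMr doubleK.
by rewrite expnM -modnXm cyclic.Euler_exp_totient // modnXm exp1n.
Qed.

(** When n has two distinct prime factors, 1 has further square roots modulo n
    besides 1 and -1; no harm is done, since the power is then always 1. *)
Lemma exp_half_totient n x : odd n -> (1 < n)%N -> (0 < x)%N -> coprime x n ->
  (n %| x ^ (totient n)./2 - 1)%N \/ (n %| x ^ (totient n)./2 + 1)%N.
Proof.
move=> n_odd n_gt1 x_gt0 co_xn.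
have [p [k [n' [p_pr p_odd n'_odd co En]]]] := odd_pfactor_split n_odd n_gt1.
have [n'1|n'_neq1] := eqVneq n' 1%N.
  rewrite n'1 muln1 in En.
  rewrite {1 3}En; apply: sqr_eq1_mod_pfactor; rewrite ?expn_gt0 ?x_gt0 //.
  rewrite -En -expnM muln2 even_halfK ?totient_odd_even //.
  exact: cyclic.Euler_exp_totient.
left; rewrite -eqn_mod_dvd ?expn_gt0 ?x_gt0 //.
have n'_gt1 : (1 < n')%N by case: n' n'_neq1 n'_odd {co En} => [|[]].
have [xp xn'] : coprime x (p ^ k.+1) /\ coprime x n'.
  by move: co_xn; rewrite En coprimeMr => /andP[].
rewrite En chinese_remainder // totient_coprime //; apply/andP; split.
  by apply/eqP; rewrite exp_half_totient_mull ?totient_odd_even.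
by apply/eqP; rewrite mulnC exp_half_totient_mull ?totient_pfactor_even.
Qed.

(** * Symmetries of the distance to the integers *)

Section DistZ.
Context {R : realType}.
Implicit Types (x : R) (i : int).

Lemma distZ_int_add i x : distZ (i%:~R + x) = distZ x.
Proof.
rewrite /distZ; congr inf; apply/seteqP; split=> _ [k _ <-] /=.
  by exists (k - i) => //; congr `| _ |; rewrite intrB; ring.
by exists (k + i) => //; congr `| _ |; rewrite intrD; ring.
Qed.

Lemma distZN x : distZ (- x) = distZ x.
Proof.
rewrite /distZ; congr inf; apply/seteqP; split=> _ [k _ <-] /=.
  by exists (- k) => //; rewrite -normrN; congr `| _ |; rewrite intrN; ring.
by exists (- k) => //; rewrite -normrN; congr `| _ |; rewrite intrN; ring.
Qed.

Lemma distZ_int i : distZ (i%:~R : R) = 0.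
Proof.
rewrite -[i%:~R]addr0 distZ_int_add; apply/eqP; rewrite eq_le; apply/andP; split.
  apply: ge_inf; last by exists 0 => //; rewrite subrr normr0.
  by exists 0 => _ [k _ <-].
by apply: lb_le_inf; [exists `|0 - 0%:~R|, 0 | move=> _ [k _ <-]].
Qed.

(** Multiplying a fraction c / n by an integer y = 1 or -1 modulo n changes it,
    up to sign, by an integer. *)
Lemma distZ_mul_sign (c n y : nat) : (0 < n)%N -> (0 < y)%N ->
  (n %| y - 1)%N \/ (n %| y + 1)%N ->
  distZ (y%:R * (c%:R / n%:R)) = distZ (c%:R / n%:R : R).
Proof.
move=> n_gt0 y_gt0 dvd; have n0 : (n%:R : R) != 0 by rewrite pnatr_eq0 -lt0n.
case: dvd => /dvdnP[q Eq].
  rewrite -(distZ_int_add (q * c)%N (_ / _)) -pmulrn natrM.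
  have -> : (y%:R : R) = q%:R * n%:R + 1 by rewrite -natrM natr1; congr _%:R; lia.
  by congr distZ; field.
rewrite -(distZN (_ / _)) -(distZ_int_add (q * c)%N (- _)) -pmulrn natrM.
have -> : (y%:R : R) = q%:R * n%:R - 1.
  by rewrite -natrM -Eq natrD addrK.
by congr distZ; field.
Qed.

End DistZ.

(** * Series with dyadic weights and eventually periodic coefficients *)

Section DyadicSeries.
Context {R : realType}.

Lemma eventually_periodic_bounded (g : nat -> R) (j l : nat) : (0 < l)%N ->
  (forall k, (j <= k)%N -> g (k + l)%N = g k) ->
  exists M, forall k, `|g k| <= M.
Proof.
move=> l_gt0 g_per; exists (\sum_(i < j + l) `|g i|).
elim/ltn_ind => k IH; have [k_lt|k_ge] := ltnP k (j + l).
  by rewrite (bigD1 (Ordinal k_lt)) //= lerDl sumr_ge0.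
have -> : k = (k - l + l)%N by lia.
by rewrite g_per; [apply: IH; lia | lia].
Qed.

(** Rescaling by 2^k turns the contraction into periodicity, so that such a
    sequence is O(2^(-k)). *)
Lemma cvg0_dyadic_selfsimilar (e : nat -> R) (j l : nat) : (0 < l)%N ->
  (forall k, (j <= k)%N -> e (k + l)%N = (2 ^+ l)^-1 * e k) ->
  e @ \oo --> 0.
Proof.
move=> l_gt0 e_sim.
have [k j_k|M HM] := @eventually_periodic_bounded (fun k => 2 ^+ k * e k) j l l_gt0.
  by rewrite e_sim // exprD -mulrA mulVKf // expf_neq0 // pnatr_eq0.
apply: norm_cvg0.
apply: (@squeeze_cvgr _ _ _ _ (fun=> 0) (geometric M 2^-1)).
- near=> k; rewrite normr_ge0 /= /geometric /= exprVn.
  rewrite ler_pdivlMr ?exprn_gt0 //.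
  by have := HM k; rewrite normrM ger0_norm ?exprn_ge0 // mulrC.
- exact: cvg_cst.
- by apply: cvg_geometric; rewrite ger0_norm // invf_lt1 // ltr1n.
Unshelve. all: by end_near. Qed.

(** The difference between the claimed sum and the partial sums is multiplied
    by 2^(-l) whenever the number of terms grows by l. *)
Lemma dyadic_series_periodic (a : nat -> R) (j l : nat) : (0 < l)%N ->
  (forall k, (j <= k)%N -> a (k + l)%N = a k) ->
  series (fun k => (2 ^+ k)^-1 * a k) @ \oo -->
    \sum_(0 <= k < j) (2 ^+ k)^-1 * a k
  + \sum_(j <= k < j + l) (2 ^+ k - 2 ^ (k%:Z - l%:Z))^-1 * a k.
Proof.
move=> l_gt0 a_per; set b := fun k => _.
set H := \sum_(0 <= k < j) _; set T := \sum_(j <= k < j + l) _.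
set q : R := (2 ^+ l)^-1.
have q1 : 1 - q != 0.
  rewrite subr_eq0 eq_sym lt_eqF // invf_lt1 ?exprn_gt0 //.
  by rewrite exprn_egt1 ?ltr1n // -lt0n.
have TE : (1 - q) * T = \sum_(j <= k < j + l) b k.
  rewrite mulr_sumr; apply: eq_bigr => k _; rewrite mulrA /b; congr (_ * _).
  have -> : 2 ^ (k%:Z - l%:Z) = 2 ^+ k * q :> R.
    by rewrite expfzDr ?pnatr_eq0 // -exprnN.
  have k0 : (2 ^+ k : R) != 0 by rewrite expf_neq0 // pnatr_eq0.
  by rewrite -{1}[2 ^+ k]mulr1 -mulrBr invfM mulrCA mulfV // mulr1.
have seriesE N : (j <= N)%N -> series b N = H + \sum_(j <= k < N) b k.
  by move=> jN; rewrite /series /= (big_cat_nat (n := j)).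
have e_sim N : (j <= N)%N ->
    H + T - series b (N + l)%N = q * (H + T - series b N).
  move=> jN; rewrite !seriesE //; last by lia.
  rewrite (@big_cat_nat _ _ _ (j + l)) ?leq_addr ?leq_add2r //= -TE.
  rewrite big_addn addnK.
  have -> : \sum_(j <= k < N) b (k + l)%N = q * \sum_(j <= k < N) b k.
    rewrite mulr_sumr; apply: eq_big_nat => k /andP[jk _].
    by rewrite /b a_per // exprD invfM mulrA [_^-1 * q]mulrC.
  by ring.
have e_cvg0 : (fun N => H + T - series b N) @ \oo --> 0.
  exact: cvg0_dyadic_selfsimilar l_gt0 e_sim.
rewrite -[H + T]subr0.
rewrite [X in X @ _ --> _](_ : _ = fun N => H + T - (H + T - series b N)).
  by apply: cvgB e_cvg0; exact: cvg_cst.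
by apply/funext => N; rewrite subKr.
Qed.

End DyadicSeries.

Unset Implicit Arguments.

(** * The summation formula *)

Lemma phistar0 (R : realType) (X : lmodType R) (phi : X -> R) :
  phi 0 = 0 -> phistar phi 0 = 0%E.
Proof.
move=> phi0; rewrite /phistar.
rewrite [X in ereal_inf X](_ : _ = [set 0%E]) ?ereal_inf1 //.
apply/seteqP; split=> [_ [k _ <-]|_ ->] /=.
  by rewrite scaler0 phi0 mulr0.
by exists 1%N => //; rewrite scaler0 phi0 mulr0.
Qed.

Theorem theorem3p7 (R : realType) (X : lmodType R) (D : set X)
    (D_nonempty : D !=set0)
    (D_convex : convex_set (D : set (convex_lmodType X)))
    (phi : X -> R) (phi_adm : admissible D phi)
    (m j n : nat) (n_ge1 : (1 <= n)%N) (n_odd : odd n)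
    (m_le : m%:R <= 2 ^ (j%:Z - 1) * n%:R :> R)
    (m_coprime : coprime m (2 ^ j * n))
    (lam : R) (lamE : lam = m%:R / (2 ^+ j * n%:R))
    (l : nat) (lE : l = (totient n)./2)
    (u : X) (hu : diffset D u) :
  series (fun k : nat =>
      (2 ^+ k)^-1 * fine (phistar phi (distZ (2 ^+ k * lam) *: u))) @ \oo -->
    \sum_(0 <= k < j)
      (2 ^+ k)^-1 * fine (phistar phi (distZ (2 ^+ k * lam) *: u))
  + \sum_(j <= k < j + l)
      (2 ^+ k - 2 ^ (k%:Z - l%:Z))^-1
        * fine (phistar phi (distZ (2 ^+ k * lam) *: u)).
Proof.
have lam_tail k : (j <= k)%N ->
    2 ^+ k * lam = (2 ^ (k - j) * m)%:R / n%:R :> R.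
  move=> /subnK {1}<-; rewrite lamE exprD natrM natrX.
  have n0 : (n%:R : R) != 0 by rewrite pnatr_eq0 -lt0n.
  by field; rewrite n0 expf_neq0.
have [n1|n_neq1] := eqVneq n 1%N.
  have tail0 k : (j <= k)%N ->
      fine (phistar phi (distZ (2 ^+ k * lam) *: u)) = 0.
    move=> jk; rewrite lam_tail // n1 divr1 pmulrn distZ_int scale0r.
    by rewrite phistar0 //; case: phi_adm.
  have := @dyadic_series_periodic R
    (fun k => fine (phistar phi (distZ (2 ^+ k * lam) *: u))) j 1 isT.
  rewrite lE n1 /= addn0 (@big_geq _ _ _ j j) // addn1 big_nat1 tail0 // mulr0.
  by apply=> k jk; rewrite !tail0 //; lia.
have n_gt1 : (1 < n)%N by rewrite ltn_neqAle eq_sym n_neq1.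
have l_gt0 : (0 < l)%N.
  by rewrite lE half_gt0 totient_gt1; lia.
apply: (@dyadic_series_periodic R
  (fun k => fine (phistar phi (distZ (2 ^+ k * lam) *: u)))) => // k jk.
congr (fine (phistar phi (_ *: u))).
rewrite addnC exprD -mulrA lam_tail // -natrX distZ_mul_sign ?expn_gt0 //.
by rewrite lE; apply: exp_half_totient => //; rewrite coprime2n.
Qed.
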